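(* Let $(X,b,\mu)$ be a weighted graph satisfying the finiteness condition (FC). Let $V_1\in C(X)$ be a real-valued function for which there exists $C\in\mathbb{R}$ such that $(\mathcal{L}_{V_1}u,u)\geq C\|u\|^2$ for all $u\in C_c(X)$. Let $L_{V_1}$ be the Friedrichs extension of $\mathcal{L}_{V_1}|_{C_c(X)}$. Then $L_{V_1}$ has a positive form core.
   Context: A symmetric weighted graph $(X,b)$ is a countable set $X\neq\emptyset$ with a function $b\colon X\times X\to[0,\infty)$ such that $b(x,y)=b(y,x)$, $b(x,x)=0$ and $\sum_{z\in X}b(x,z)<\infty$ for all $x,y\in X$. A weight is a function $\mu\colon X\to(0,\infty)$; $(X,b,\mu)$ is called a weighted graph. $C(X)$ is the set of all functions $X\to\mathbb{C}$, $C_c(X)$ the set of finitely supported ones. $\ell^2_\mu(X)$ is the Hilbert space of $f\in C(X)$ with $\sum_x\mu(x)|f(x)|^2<\infty$, with inner product $(f,g)=\sum_x\mu(x)f(x)\overline{g(x)}$ and norm $\|\cdot\|$. Finiteness condition (FC): for every $x\in X$ the function $y\mapsto b(x,y)/\mu(y)$ belongs to $\ell^2_\mu(X)$. For real-valued $V\in C(X)$, the formal Schrödinger operator $\mathcal{L}_V$ is defined on $\mathcal{F}=\{f\in C(X): \sum_{y}b(x,y)|f(y)|<\infty \text{ for all } x\in X\}$ by $\mathcal{L}_Vf(x)=\frac{1}{\mu(x)}\sum_{y\in X}b(x,y)(f(x)-f(y))+V(x)f(x)$. Under (FC), $\mathcal{L}_V$ maps $C_c(X)$ into $\ell^2_\mu(X)$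 and $\mathcal{L}_V|_{C_c(X)}$ is a symmetric operator in $\ell^2_\mu(X)$. Let $T$ be a symmetric lower semi-bounded operator in $\ell^2_\mu(X)$ with domain $C_c(X)$, let $t$ be the closure of the (closable) form $u\mapsto(Tu,u)$, $u\in C_c(X)$, with domain $\mathrm{D}(t)$, and let $T_F$ (the Friedrichs extension of $T$) be the self-adjoint operator associated to $t$. Let $\lambda_0(t)$ be the largest $c\in\mathbb{R}$ with $t(u)\geq c\|u\|^2$ for all $u\in\mathrm{D}(t)$. The form norm is $\|u\|_t^2=t(u)+(\beta-\lambda_0(t))\|u\|^2$ for a fixed $\beta>0$ (different $\beta>0$ give equivalent norms). For $G\subseteq C(X)$, $G^+$ denotes the set of non-negative functions in $G$. $T_F$ has a positive form core if for every $u\in[\mathrm{D}(t)]^+$ there is a sequence $u_k\in[C_c(X)]^+$ with $\|u_k-u\|_t\to0$ as $k\to\infty$. *)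

(* Defs.v *)
From HB Require Import structures.
From mathcomp Require Import all_boot all_order all_algebra.
From mathcomp Require Import all_classical all_reals all_analysis.
From mathcomp Require Import complex.

Set Implicit Arguments.
Unset Strict Implicit.
Unset Printing Implicit Defensive.
Import Order.TTheory GRing.Theory Num.Theory.
Import numFieldNormedType.Exports.
Local Open Scope classical_set_scope.
Local Open Scope ring_scope.
Local Open Scope complex_scope.

(* The library's complex numbers R[i] carry an R[i]-valued norm; ComplexField.normc
   is the R-valued modulus. *)
Notation cmod := ComplexField.Normc.normc.

Definition weighted_graph (R : realType) (X : countType)
    (b : X -> X -> R) (mu : X -> R) : Prop :=
  inhabited X /\
  (forall x y, 0 <= b x y) /\
  (forall x y, b x y = b y x) /\
  (forall x, b x x = 0) /\
  (forall x, (\esum_(z in [set: X]) (b x z)%:E < +oo)%E) /\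
  (forall x, 0 < mu x).

(* Sums over X of absolutely summable families; junk value otherwise. *)
Definition rsum (R : realType) (X : countType) (f : X -> R) : R :=
  fine (\esum_(x in [set: X]) (Num.max (f x) 0)%:E)
  - fine (\esum_(x in [set: X]) (Num.max (- f x) 0)%:E).

Definition csum (R : realType) (X : countType) (f : X -> R[i]) : R[i] :=
  rsum (fun x => complex.Re (f x)) +i* rsum (fun x => complex.Im (f x)).

Definition finsupp_fun (R : realType) (X : countType) : set (X -> R[i]) :=
  [set u | finite_set [set x | u x != 0]].

(* In the order of R[i], 0 <= z means that z is real and non-negative. *)
Definition nonneg_part (R : realType) (X : countType) (G : set (X -> R[i])) :
    set (X -> R[i]) :=
  [set u | G u /\ forall x, 0 <= u x].

Definition l2 (R : realType) (X : countType) (mu : X -> R) : set (X -> R[i]) :=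
  [set f | (\esum_(x in [set: X]) (mu x * cmod (f x) ^+ 2)%:E < +oo)%E].

Definition inner (R : realType) (X : countType) (mu : X -> R)
    (f g : X -> R[i]) : R[i] :=
  csum (fun x => (mu x)%:C * f x * (g x)^*).

Definition l2norm (R : realType) (X : countType) (mu : X -> R)
    (f : X -> R[i]) : R :=
  Num.sqrt (complex.Re (inner mu f f)).

Definition FC (R : realType) (X : countType) (b : X -> X -> R) (mu : X -> R) :
    Prop :=
  forall x, l2 mu (fun y => (b x y / mu y)%:C).

(* The values of oapp outside odom are irrelevant. *)
Record operator (R : realType) (X : countType) := Operator {
  odom : set (X -> R[i]);
  oapp :> (X -> R[i]) -> (X -> R[i]) }.

Definition restrict_op (R : realType) (X : countType) (T : operator R X)
    (D : set (X -> R[i])) : operator R X :=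
  Operator (odom T `&` D) (oapp T).

Definition schrodinger (R : realType) (X : countType)
    (b : X -> X -> R) (mu V : X -> R) : operator R X :=
  Operator
    [set f | forall x, (\esum_(y in [set: X]) (b x y * cmod (f y))%:E < +oo)%E]
    (fun f x => ((mu x)^-1)%:C * csum (fun y => (b x y)%:C * (f x - f y))
                + (V x)%:C * f x).

(* Sesquilinear forms, linear in the first argument; the values of fval
   outside fdom are irrelevant. *)
Record form (R : realType) (X : countType) := Form {
  fdom : set (X -> R[i]);
  fval : (X -> R[i]) -> (X -> R[i]) -> R[i] }.

(* The diagonal values of the symmetric forms considered are real, so taking
   the real part only changes the type. *)
Definition qform (R : realType) (X : countType) (t : form R X)
    (u : X -> R[i]) : R :=
  complex.Re (fval t u u).

Definition form_of_op (R : realType) (X : countType) (mu : X -> R)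
    (T : operator R X) : form R X :=
  Form (odom T) (fun u v => inner mu (T u) v).

(* u_k --> u in l2, with u_k in the domain of s and s(u_m - u_n) --> 0 as
   m, n --> oo. *)
Definition form_cvg (R : realType) (X : countType) (mu : X -> R)
    (s : form R X) (u_ : nat -> X -> R[i]) (u : X -> R[i]) : Prop :=
  [/\ forall k, fdom s (u_ k),
      l2 mu u,
      l2norm mu (u_ k \- u) @[k --> \oo] --> (0 : R) &
      qform s (u_ p.1 \- u_ p.2) @[p --> (\oo, \oo)] --> (0 : R)].

(* The closure of a closable lower semi-bounded form s.  Closability makes the
   limit below exist and not depend on the approximating sequences, so xget
   picks the only candidate. *)
Definition form_closure (R : realType) (X : countType) (mu : X -> R)
    (s : form R X) : form R X :=
  Form
    [set u | exists u_, form_cvg mu s u_ u]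
    (fun u v => xget 0 [set z | exists u_ v_,
       [/\ form_cvg mu s u_ u, form_cvg mu s v_ v &
           cmod (fval s (u_ k) (v_ k) - z) @[k --> \oo] --> (0 : R)]]).

(* A u = f with f in l2 iff t(u, w) = (f, w) for all w in the domain of t;
   f is unique when t is densely defined. *)
Definition represents (R : realType) (X : countType) (mu : X -> R)
    (t : form R X) (u f : X -> R[i]) : Prop :=
  l2 mu f /\ forall w, fdom t w -> fval t u w = inner mu f w.

Definition op_of_form (R : realType) (X : countType) (mu : X -> R)
    (t : form R X) : operator R X :=
  Operator
    [set u | fdom t u /\ exists f, represents mu t u f]
    (fun u => xget (fun=> 0) [set f | represents mu t u f]).

(* An operator bundled with the form it is associated to, because the notion of
   a positive form core of an operator refers to its form. *)
Record form_operator (R : realType) (X : countType) (mu : X -> R) :=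
  FormOperator {
    the_form : form R X;
    the_op :> operator R X;
    the_opE : the_op = op_of_form mu the_form }.

Definition friedrichs (R : realType) (X : countType) (mu : X -> R)
    (T : operator R X) : form_operator mu :=
  let t := form_closure mu (form_of_op mu T) in
  FormOperator (erefl (op_of_form mu t)).

Definition lambda0 (R : realType) (X : countType) (mu : X -> R)
    (t : form R X) : R :=
  sup [set c | forall u, fdom t u -> c * l2norm mu u ^+ 2 <= qform t u].

Definition form_norm (R : realType) (X : countType) (mu : X -> R) (beta : R)
    (t : form R X) (u : X -> R[i]) : R :=
  Num.sqrt (qform t u + (beta - lambda0 mu t) * l2norm mu u ^+ 2).

Definition has_positive_form_core (R : realType) (X : countType)
    (mu : X -> R) (beta : R) (A : form_operator mu) : Prop :=
  forall u, nonneg_part (fdom (the_form A)) u ->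
  exists u_ : nat -> X -> R[i],
    (forall k, nonneg_part (@finsupp_fun R X) (u_ k)) /\
    form_norm mu beta (the_form A) (u_ k \- u) @[k --> \oo] --> (0 : R).

(* Main.v *)
Require Import Defs.
From mathcomp Require Import all_boot all_order all_algebra.
From mathcomp Require Import all_classical all_reals all_analysis.
From mathcomp Require Import complex.
From mathcomp Require Import ring lra.

Set Implicit Arguments.
Unset Strict Implicit.
Unset Printing Implicit Defensive.
Import Order.TTheory GRing.Theory Num.Theory.
Import numFieldNormedType.Exports.
Local Open Scope classical_set_scope.
Local Open Scope ring_scope.
Local Open Scope complex_scope.

(** Let $a(v) = (L v, v) - C \|v\|^2$ on finitely supported functions, where
    $L$ is the Schroedinger operator and $C$ a lower bound of its form, so that
    $a \geq 0$.  The off-diagonal matrix entries of $L$ are $-b(x,y) \leq 0$,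
    and therefore $a(|v|) \leq a(v)$ ([energy_cmod]).

    Let $u \geq 0$ be in the domain of the closed form, and let $\phi_k$ be
    finitely supported with $\phi_k \to u$ in $\ell^2$ and
    $a(\phi_k - \phi_l) \to 0$.  The functions $|\phi_k|$ are non-negative,
    converge to $u$ in $\ell^2$ and have bounded energy, but they need not
    converge in the form norm.  The usual remedy is to take convex combinations
    of a weakly convergent subsequence.  The same effect is obtained without
    weak compactness by minimisation: the sets $K_n$ of non-negative finitely
    supported $v$ with $\|v - u\|^2 \leq 1/(n+1)$ are convex and decreasing,
    the infima of $a$ on them increase and are bounded because $K_n$ contains
    $|\phi_k|$ for large $k$, and the parallelogram identity makes any sequence
    of near-minimisers $v_n \in K_n$ Cauchy for $a$
    ([minimizing_sequence_close], [nonneg_approximation]).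

    It remains to see that $v_n \to u$ in the norm of the closed form, that is,
    that the closed form is small at $v_n - u$
    ([form_closure_eventually_small]).  This needs closability: a finitely
    supported sequence that is Cauchy for $a$ and tends to $0$ in $\ell^2$ has
    energies tending to $0$ ([energy_closable]).  Closability holds because, by
    the finiteness condition, the rows of the matrix of $L$ are in
    $\ell^2$, so that $w \mapsto a(w, v)$ is continuous in $\ell^2$ for each
    finitely supported $v$ ([energy_bound]). *)

(** * Sums of absolutely summable real families *)

Section Sums.
Context {R : realType} {X : countType}.
Implicit Types (f g : X -> R) (r : seq X).

Definition abs_summable f : Prop :=
  (\esum_(x in [set: X]) `|f x|%:E < +oo)%E.

Lemma le_abs_summable f g :
  (forall x, `|f x| <= `|g x|) -> abs_summable g -> abs_summable f.
Proof.
by move=> fg; apply: le_lt_trans; apply: le_esum => x _; rewrite lee_fin.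
Qed.

(** Both inequalities come from the same one-sided estimate, used for the
    factors $c$ and $c^{-1}$. *)
Lemma esumZ (c : R) f : 0 <= c -> (forall x, 0 <= f x) ->
  (\esum_(x in [set: X]) (c * f x)%:E = c%:E * \esum_(x in [set: X]) (f x)%:E)%E.
Proof.
move=> c0 f0.
have le_scale (k : R) (h : X -> R) : 0 <= k ->
    (\esum_(x in [set: X]) (k * h x)%:E <= k%:E * \esum_(x in [set: X]) (h x)%:E)%E.
  move=> k0; apply: ge_ereal_sup => _ [A [finA AT] <-].
  rewrite fsbig_finite//= sumEFin -mulr_sumr EFinM -sumEFin -fsbig_finite//.
  by apply: lee_wpmul2l; rewrite ?lee_fin//; apply: ereal_sup_ubound; exists A.
apply/eqP; rewrite eq_le le_scale//=.
move: c0; rewrite le0r => /predU1P[->|c0].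
  by rewrite mul0e; apply: esum_ge0 => x _; rewrite mul0r.
rewrite -lee_pdivlMl//.
apply: le_trans (le_scale _ _ _); last by rewrite invr_ge0 ltW.
by apply: le_esum => x _; rewrite mulKf ?gt_eqF.
Qed.

Lemma abs_summableD f g :
  abs_summable f -> abs_summable g -> abs_summable (fun x => f x + g x).
Proof.
move=> sf sg; apply: (@le_lt_trans _ _
  (\esum_(x in [set: X]) (`|f x|%:E + `|g x|%:E))%E).
  by apply: le_esum => x _; rewrite -EFinD lee_fin ler_normD.
by rewrite esumD ?lte_add_pinfty// => x _; rewrite lee_fin.
Qed.

Lemma abs_summableZ (c : R) f :
  abs_summable f -> abs_summable (fun x => c * f x).
Proof.
move=> sf; rewrite /abs_summable; under eq_esum do rewrite normrM.
by rewrite esumZ// lte_mul_pinfty// lee_fin.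
Qed.

Lemma abs_summableB f g :
  abs_summable f -> abs_summable g -> abs_summable (fun x => f x - g x).
Proof.
move=> sf sg; apply: abs_summableD => //.
by apply: le_abs_summable sg => x; rewrite normrN.
Qed.

Lemma esum_seq f r : uniq r -> (forall x, 0 <= f x) ->
  (forall x, x \notin r -> f x = 0) ->
  (\esum_(x in [set: X]) (f x)%:E = (\sum_(x <- r) f x)%:E)%E.
Proof.
move=> ur f0 fr; rewrite -sumEFin fsbig_seq// -esum_fset//; last first.
  by move=> x _; rewrite lee_fin.
rewrite [RHS]esum_mkcond; apply: eq_esum => x _.
case: ifPn => // xr; rewrite fr//; apply: contra xr => xr.
by rewrite inE.
Qed.

Lemma abs_summable_seq f r : uniq r -> (forall x, x \notin r -> f x = 0) ->
  abs_summable f.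
Proof.
move=> ur fr; rewrite /abs_summable (esum_seq ur) ?ltry// => x /fr ->.
by rewrite normr0.
Qed.

Lemma rsum_seq f r : uniq r -> (forall x, x \notin r -> f x = 0) ->
  rsum f = \sum_(x <- r) f x.
Proof.
move=> ur fr; have frN x : x \notin r -> - f x = 0 by move=> /fr ->; rewrite oppr0.
have max0 (z : R) : 0 <= Num.max z 0 by rewrite le_max lexx orbT.
rewrite /rsum !(esum_seq ur) //=; try by move=> x /[dup] /fr -> /frN ?; rewrite ?oppr0 maxxx.
rewrite -sumrB; apply: eq_bigr => x _.
by case: (leP (f x) 0) => h; case: (leP (- f x) 0) => h'; lra.
Qed.

Lemma rsum_ge0E f : (forall x, 0 <= f x) ->
  rsum f = fine (\esum_(x in [set: X]) (f x)%:E)%E.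
Proof.
move=> f0; rewrite /rsum [X in _ - fine X]esum1 ?subr0//; last first.
  by move=> x _; rewrite max_r ?oppr_le0.
by congr fine; apply: eq_esum => x _; rewrite max_l.
Qed.

Lemma rsum_ge0 f : (forall x, 0 <= f x) -> 0 <= rsum f.
Proof.
by move=> f0; rewrite rsum_ge0E// fine_ge0// esum_ge0// => x _; rewrite lee_fin.
Qed.

Lemma abs_summable_fin_num f : (forall x, 0 <= f x) -> abs_summable f ->
  (\esum_(x in [set: X]) (f x)%:E)%E \is a fin_num.
Proof.
move=> f0 sf; rewrite ge0_fin_numE; last first.
  by apply: esum_ge0 => x _; rewrite lee_fin.
by apply: le_lt_trans sf; apply: le_esum => x _; rewrite lee_fin ler_norm.
Qed.

Lemma rsumB_ge0 f g : (forall x, 0 <= f x) -> (forall x, 0 <= g x) ->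
  abs_summable f -> abs_summable g ->
  rsum (fun x => f x - g x) = rsum f - rsum g.
Proof.
move=> f0 g0 sf sg.
have /(congr1 fine) := @esumB R X [set: X] (EFin \o f) (EFin \o g) sf sg
  (fun x _ => f0 x) (fun x _ => g0 x).
rewrite [in RHS]fineB ?abs_summable_fin_num// -!rsum_ge0E// => <-.
rewrite /rsum -fineB.
- by congr (fine (_ - _)); apply: eq_esum => x _;
    rewrite ?funeposE ?funenegE/= -?EFinB -?EFinN EFin_max.
- apply: abs_summable_fin_num => [x|]; first by rewrite le_max lexx orbT.
  apply: le_abs_summable (abs_summableB sf sg) => x.
  by case: (leP (f x - g x) 0) => h; rewrite ?normr0.
- apply: abs_summable_fin_num => [x|]; first by rewrite le_max lexx orbT.
  apply: le_abs_summable (abs_summableB sf sg) => x.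
  by case: (leP (- (f x - g x)) 0) => h; rewrite ?normr0// normrN.
Qed.

Lemma rsumD_ge0 f g : (forall x, 0 <= f x) -> (forall x, 0 <= g x) ->
  abs_summable f -> abs_summable g ->
  rsum (fun x => f x + g x) = rsum f + rsum g.
Proof.
move=> f0 g0 sf sg; rewrite !rsum_ge0E//; last by move=> x; rewrite addr_ge0.
rewrite -fineD ?abs_summable_fin_num// -esumD// => x _; rewrite lee_fin//.
Qed.

Lemma rsumN f : rsum (fun x => - f x) = - rsum f.
Proof.
rewrite /rsum opprB; congr (_ - fine _).
by apply: eq_esum => x _; rewrite opprK.
Qed.

(** The positive part of a sum is not the sum of the positive parts, so both
    sides are compared with the decomposition
    $(f^+ + g^+) - (f^- + g^-)$ through [rsumB_ge0]. *)
Lemma rsumD f g : abs_summable f -> abs_summable g ->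
  rsum (fun x => f x + g x) = rsum f + rsum g.
Proof.
pose P (h : X -> R) x := Num.max (h x) 0.
pose M (h : X -> R) x := Num.max (- h x) 0.
have P0 h x : 0 <= P h x by rewrite le_max lexx orbT.
have M0 h x : 0 <= M h x by rewrite le_max lexx orbT.
have E h x : h x = P h x - M h x.
  by rewrite /P /M; case: (leP (h x) 0); case: (leP (- h x) 0); lra.
have sP h : abs_summable h -> abs_summable (P h).
  by apply: le_abs_summable => x; rewrite /P; case: (leP (h x) 0) => _; rewrite ?normr0.
have sM h : abs_summable h -> abs_summable (M h).
  by apply: le_abs_summable => x; rewrite /M; case: (leP (- h x) 0) => _;
     rewrite ?normr0// normrN.
move=> sf sg.
rewrite (_ : (fun x => f x + g x) =
  (fun x => (P f x + P g x) - (M f x + M g x))); last first.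
  by apply/funext => x; rewrite {1}(E f) {1}(E g) opprD addrACA.
rewrite rsumB_ge0; first last.
- by apply: abs_summableD; apply: sM.
- by apply: abs_summableD; apply: sP.
- by move=> x; rewrite addr_ge0.
- by move=> x; rewrite addr_ge0.
rewrite (rsumD_ge0 (P0 f) (P0 g) (sP _ sf) (sP _ sg)).
rewrite (rsumD_ge0 (M0 f) (M0 g) (sM _ sf) (sM _ sg)) opprD addrACA.
rewrite -(rsumB_ge0 (P0 f) (M0 f) (sP _ sf) (sM _ sf)).
rewrite -(rsumB_ge0 (P0 g) (M0 g) (sP _ sg) (sM _ sg)).
have EF h : (fun x => P h x - M h x) = h by apply/funext => x; rewrite -E.
by rewrite !EF.
Qed.

(** For divergent sums the identity persists because [fine] sends them to 0,
    which is compatible with real factors. *)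
Lemma rsumZ (c : R) f : rsum (fun x => c * f x) = c * rsum f.
Proof.
wlog c0 : c / 0 <= c => [H|].
  case: (leP 0 c) => [/H//|c0].
  rewrite -[c]opprK mulNr -H ?oppr_ge0 ?ltW// -rsumN.
  by congr rsum; apply/funext => x; rewrite mulNr.
rewrite /rsum mulrBr -mulrN.
have fineZ (x : \bar R) : fine (c%:E * x)%E = c * fine x.
  case: x => [x|/=|/=] //; rewrite ?mulr0//.
  - by have [->|c1] := eqVneq c 0; rewrite ?mul0e// gt0_muley ?lte_fin ?lt0r ?c1.
  - by have [->|c1] := eqVneq c 0; rewrite ?mul0e// gt0_muleNy ?lte_fin ?lt0r ?c1.
rewrite mulrN -!fineZ -!esumZ//; try by move=> x; rewrite le_max lexx orbT.
by congr (fine _ - fine _); apply: eq_esum => x _; rewrite maxr_pMr// mulr0 ?mulrN.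
Qed.

Lemma rsumB f g : abs_summable f -> abs_summable g ->
  rsum (fun x => f x - g x) = rsum f - rsum g.
Proof.
move=> sf sg; rewrite rsumD ?rsumN//.
by apply: le_abs_summable sg => x; rewrite normrN.
Qed.

Lemma ler_rsum f g : (forall x, f x <= g x) ->
  abs_summable f -> abs_summable g -> rsum f <= rsum g.
Proof.
move=> fg sf sg; rewrite -subr_ge0 -rsumB//.
by apply: rsum_ge0 => x; rewrite subr_ge0.
Qed.

Lemma ler_sum_rsum f r : (forall x, 0 <= f x) -> abs_summable f -> uniq r ->
  \sum_(x <- r) f x <= rsum f.
Proof.
move=> f0 sf ur; pose g x := if x \in r then f x else 0.
have gr x : x \notin r -> g x = 0 by rewrite /g => /negPf ->.
rewrite [leLHS](_ : _ = \sum_(x <- r) g x); last first.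
  by apply: eq_big_seq => x xr; rewrite /g xr.
rewrite -(rsum_seq ur gr) ler_rsum//; last exact: abs_summable_seq gr.
by move=> x; rewrite /g; case: ifP.
Qed.

End Sums.

(** * The real inner product of complex numbers *)

Section Dot.
Context {R : realType}.
Implicit Types (z w : R[i]).

Definition re_dot z w : R :=
  complex.Re z * complex.Re w + complex.Im z * complex.Im w.

Lemma re_dotC z w : re_dot z w = re_dot w z.
Proof. by rewrite /re_dot mulrC [X in _ + X]mulrC. Qed.

Lemma re_dotDl z z' w : re_dot (z + z') w = re_dot z w + re_dot z' w.
Proof. by case: z => a b; case: z' => c d; rewrite /re_dot /=; ring. Qed.

Lemma re_dotBl z z' w : re_dot (z - z') w = re_dot z w - re_dot z' w.
Proof. by case: z => a b; case: z' => c d; rewrite /re_dot /=; ring. Qed.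

Lemma re_dotDr z w w' : re_dot z (w + w') = re_dot z w + re_dot z w'.
Proof. by rewrite re_dotC re_dotDl !(re_dotC z). Qed.

Lemma re_dotBr z w w' : re_dot z (w - w') = re_dot z w - re_dot z w'.
Proof. by rewrite re_dotC re_dotBl !(re_dotC z). Qed.

Lemma re_dot0l w : re_dot 0 w = 0.
Proof. by rewrite /re_dot /= !mul0r addr0. Qed.

Lemma re_dot0r z : re_dot z 0 = 0.
Proof. by rewrite re_dotC re_dot0l. Qed.

Lemma re_dot_ge0 z : 0 <= re_dot z z.
Proof. by rewrite /re_dot -!expr2 addr_ge0 ?sqr_ge0. Qed.

Lemma re_dot_sqr z : re_dot z z = cmod z ^+ 2.
Proof.
by case: z => a b; rewrite /re_dot /= sqr_sqrtr ?addr_ge0 ?sqr_ge0 -?expr2.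
Qed.

Lemma re_dot_cmod z w : re_dot (cmod z)%:C (cmod w)%:C = cmod z * cmod w.
Proof. by rewrite /re_dot /= mulr0 addr0. Qed.

Lemma cmod_ge0 z : 0 <= cmod z.
Proof. by case: z => a b; rewrite sqrtr_ge0. Qed.

Lemma norm_Re_le z : `|complex.Re z| <= cmod z.
Proof.
rewrite -ler_sqr ?nnegrE ?cmod_ge0// -re_dot_sqr real_normK ?num_real// /re_dot expr2.
by rewrite lerDl -expr2 sqr_ge0.
Qed.

Lemma re_dot_le z w : re_dot z w <= cmod z * cmod w.
Proof.
case: (leP (re_dot z w) 0) => [/le_trans-> //|h]; first by rewrite mulr_ge0 ?cmod_ge0.
rewrite -ler_sqr ?nnegrE ?(ltW h)// ?mulr_ge0 ?cmod_ge0//.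
rewrite exprMn -!re_dot_sqr /re_dot; case: z w {h} => a b [c d] /=.
by have := sqr_ge0 (a * d - b * c); nra.
Qed.

End Dot.

(** * The squared norm and finitely supported functions *)

Section Sqnorm.
Context {R : realType} {X : countType} (mu : X -> R).
Context (mu_gt0 : forall x, 0 < mu x).
Implicit Types (f g h u v w : X -> R[i]) (r : seq X).

Lemma Re_inner f g :
  complex.Re (inner mu f g) = rsum (fun x => mu x * re_dot (f x) (g x)).
Proof.
rewrite /inner /csum /=; congr rsum; apply/funext => x.
by case: (f x) => a b; case: (g x) => c d; rewrite /re_dot /=; ring.
Qed.

Definition sqnorm f : R := rsum (fun x => mu x * re_dot (f x) (f x)).

Lemma mu_re_dot_ge0 f x : 0 <= mu x * re_dot (f x) (f x).
Proof. by rewrite mulr_ge0 ?re_dot_ge0// ltW. Qed.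

Lemma sqnorm_ge0 f : 0 <= sqnorm f.
Proof. by apply: rsum_ge0 => x; apply: mu_re_dot_ge0. Qed.

Lemma l2norm_sqr f : l2norm mu f ^+ 2 = sqnorm f.
Proof. by rewrite /l2norm Re_inner sqr_sqrtr ?sqnorm_ge0. Qed.

Lemma l2E f : l2 mu f <-> abs_summable (fun x => mu x * re_dot (f x) (f x)).
Proof.
rewrite /l2 /abs_summable /=.
under eq_esum do rewrite -re_dot_sqr.
by under [in X in _ <-> X]eq_esum do rewrite ger0_norm ?mu_re_dot_ge0//.
Qed.

(** The one comparison principle behind all norm estimates below: a pointwise
    quadratic inequality gives membership in $\ell^2$ and the same inequality
    for the squared norms. *)
Lemma sqnorm_le c f g h : 0 <= c ->
  (forall x, re_dot (h x) (h x) <=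
             c * (re_dot (f x) (f x) + re_dot (g x) (g x))) ->
  l2 mu f -> l2 mu g ->
  l2 mu h /\ sqnorm h <= c * (sqnorm f + sqnorm g).
Proof.
move=> c0 hfg /l2E sf /l2E sg.
have hle x : mu x * re_dot (h x) (h x) <=
    c * (mu x * re_dot (f x) (f x) + mu x * re_dot (g x) (g x)).
  by rewrite -mulrDr mulrCA ler_pM2l.
have sfg := abs_summableZ c (abs_summableD sf sg).
have sh : abs_summable (fun x => mu x * re_dot (h x) (h x)).
  apply: le_abs_summable sfg => x.
  by rewrite ger0_norm ?mu_re_dot_ge0// (le_trans (hle x))// ler_norm.
split; first exact/l2E.
by rewrite /sqnorm -rsumD// -rsumZ; apply: ler_rsum.
Qed.

Lemma sqnormD_le f g : l2 mu f -> l2 mu g ->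
  l2 mu (f \+ g) /\ sqnorm (f \+ g) <= 2 * (sqnorm f + sqnorm g).
Proof.
apply: sqnorm_le => // x; rewrite re_dotDl !re_dotDr (re_dotC (g x)).
by have := re_dot_ge0 (f x - g x); rewrite re_dotBl !re_dotBr (re_dotC (g x)); lra.
Qed.

Lemma sqnormB_le f g : l2 mu f -> l2 mu g ->
  l2 mu (f \- g) /\ sqnorm (f \- g) <= 2 * (sqnorm f + sqnorm g).
Proof.
apply: sqnorm_le => // x; rewrite re_dotBl !re_dotBr (re_dotC (g x)).
by have := re_dot_ge0 (f x + g x); rewrite re_dotDl !re_dotDr (re_dotC (g x)); lra.
Qed.

(** Two finitely supported functions are handled through a common list of
    vertices, which turns the sums over the graph into finite sums. *)
Lemma finsupp_seq u v : finsupp_fun u -> finsupp_fun v ->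
  exists r : seq X, [/\ uniq r, forall x, x \notin r -> u x = 0 &
                        forall x, x \notin r -> v x = 0].
Proof.
move=> fu fv; have fuv : finite_set ([set x | u x != 0] `|` [set x | v x != 0]).
  by rewrite finite_setU.
have [s sE] := (finite_seqP _).1 fuv; exists (undup s).
have out x : x \notin undup s -> ~ (u x != 0 \/ v x != 0).
  rewrite mem_undup => /negP xs ux; apply: xs.
  by have : ([set x | u x != 0] `|` [set x | v x != 0]) x by []; rewrite sE.
split=> [|x /out h|x /out h]; first exact: undup_uniq.
- by apply/eqP/negPn/negP => ux; apply: h; left.
- by apply/eqP/negPn/negP => vx; apply: h; right.
Qed.

Lemma finsupp_sub u v w : finsupp_fun u -> finsupp_fun v ->
  (forall x, u x = 0 -> v x = 0 -> w x = 0) -> finsupp_fun w.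
Proof.
move=> fu fv uvw; apply: (@sub_finite_set _ _
    ([set x | u x != 0] `|` [set x | v x != 0])); last by rewrite finite_setU.
move=> x /= wx; case: (eqVneq (u x) 0) => ux; last by left.
case: (eqVneq (v x) 0) => vx; last by right.
by rewrite uvw ?eqxx in wx.
Qed.

Lemma finsuppD u v : finsupp_fun u -> finsupp_fun v -> finsupp_fun (u \+ v).
Proof. by move=> fu fv; apply: finsupp_sub fu fv _ => x /= -> ->; rewrite addr0. Qed.

Lemma finsuppB u v : finsupp_fun u -> finsupp_fun v -> finsupp_fun (u \- v).
Proof. by move=> fu fv; apply: finsupp_sub fu fv _ => x /= -> ->; rewrite subr0. Qed.

Lemma finsupp_l2 u : finsupp_fun u -> l2 mu u.
Proof.
move=> fu; have [r [ur u0 _]] := finsupp_seq fu fu.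
by apply/l2E; apply: (abs_summable_seq ur) => x /u0 ->; rewrite re_dot0l mulr0.
Qed.

End Sqnorm.

(** * Real bilinear forms given by a matrix *)

Section Gram.
Context {R : realType} {X : countType}.
Implicit Types (k : X -> X -> R) (u v w : X -> R[i]) (r : seq X).

Definition gram r k u v : R :=
  \sum_(x <- r) \sum_(y <- r) k x y * re_dot (u y) (v x).

Lemma gramC r k u v : (forall x y, k x y = k y x) ->
  gram r k u v = gram r k v u.
Proof.
move=> ksym; rewrite /gram exchange_big; apply: eq_bigr => x _.
by apply: eq_bigr => y _; rewrite ksym re_dotC.
Qed.

Lemma gramDl r k u v w : gram r k (u \+ v) w = gram r k u w + gram r k v w.
Proof.
rewrite /gram -big_split; apply: eq_bigr => x _.
by rewrite -big_split; apply: eq_bigr => y _; rewrite /= re_dotDl mulrDr.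
Qed.

(** Off the diagonal the entries are non-positive and
    $\mathrm{Re}(z \bar w) \leq |z||w|$, while on the diagonal both sides
    agree. *)
Lemma gram_cmod_le r k u : (forall x y, x != y -> k x y <= 0) ->
  gram r k (fun x => (cmod (u x))%:C) (fun x => (cmod (u x))%:C) <= gram r k u u.
Proof.
move=> kle; apply: ler_sum => x _; apply: ler_sum => y _.
rewrite re_dot_cmod; have [->|xy] := eqVneq x y.
  by rewrite re_dot_sqr expr2.
by apply: ler_wnM2l; [exact: kle|exact: re_dot_le].
Qed.

End Gram.

Lemma sum_delta (R : realType) (X : countType) (r : seq X) (x : X)
    (c : X -> R) : uniq r -> x \in r ->
  \sum_(y <- r) (if x == y then c y else 0) = c x.
Proof.
move=> ur xr; rewrite (bigD1_seq x)//= eqxx big1 ?addr0// => y yx.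
by rewrite eq_sym (negPf yx).
Qed.

(** * The matrix of a Schroedinger operator *)

Section Kernel.
Context {R : realType} {X : countType} (b : X -> X -> R) (mu : X -> R).
Context (hG : weighted_graph b mu).
Implicit Types (u v : X -> R[i]) (V : X -> R).

(** The entries carry the weight of the $\ell^2$ inner product: they are
    $\mu(x) (L \delta_y)(x)$, which makes the matrix symmetric. *)
Definition schr_kernel V (x y : X) : R :=
  (if x == y then rsum (b y) + mu y * V y else 0) - b x y.

Lemma schr_kernelC V x y : schr_kernel V x y = schr_kernel V y x.
Proof.
case: hG => _ [_ [bC _]].
by rewrite /schr_kernel bC eq_sym; case: eqVneq => // ->.
Qed.

Lemma schr_kernel_le0 V x y : x != y -> schr_kernel V x y <= 0.
Proof.
case: hG => _ [b0 _] /negPf xy.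
by rewrite /schr_kernel xy sub0r oppr_le0.
Qed.

Lemma b_summable x : abs_summable (b x).
Proof.
case: hG => _ [b0 [_ [_ [sb _]]]]; rewrite /abs_summable.
by under eq_esum do rewrite ger0_norm//.
Qed.

Lemma rsum_diff (r : seq X) x (c : R) (g : X -> R) : uniq r ->
  (forall y, y \notin r -> g y = 0) ->
  rsum (fun y => b x y * (c - g y)) = rsum (b x) * c - \sum_(y <- r) b x y * g y.
Proof.
move=> ur g0; have bg0 y : y \notin r -> b x y * g y = 0 by move=> /g0 ->; rewrite mulr0.
rewrite -(rsum_seq ur bg0) mulrC -rsumZ -rsumB.
- by congr rsum; apply/funext => y; rewrite mulrBr [c * _]mulrC.
- exact/abs_summableZ/b_summable.
- exact: abs_summable_seq bg0.
Qed.

Lemma schrodinger_gram V (r : seq X) u v : uniq r ->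
  (forall x, x \notin r -> u x = 0) -> (forall x, x \notin r -> v x = 0) ->
  complex.Re (inner mu (schrodinger b mu V u) v) = gram r (schr_kernel V) u v.
Proof.
move=> ur u0 v0; rewrite Re_inner (rsum_seq ur); last first.
  by move=> x /v0 ->; rewrite re_dot0r mulr0.
rewrite /gram; apply: eq_big_seq => x xr.
have [_ [_ [_ [_ [_ mu0]]]]] := hG.
have -> : \sum_(y <- r) schr_kernel V x y * re_dot (u y) (v x) =
    (rsum (b x) + mu x * V x) * re_dot (u x) (v x)
    - \sum_(y <- r) b x y * re_dot (u y) (v x).
  rewrite -(sum_delta
    (fun y => (rsum (b y) + mu y * V y) * re_dot (u y) (v x)) ur xr) -sumrB.
  apply: eq_bigr => y _; rewrite /schr_kernel mulrBl.
  by case: eqVneq; rewrite ?mul0r.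
rewrite /schrodinger /= /csum /=.
have -> : (fun y => complex.Re ((b x y)%:C * (u x - u y))) =
          (fun y => b x y * (complex.Re (u x) - complex.Re (u y))).
  by apply/funext => y; case: (u x) (u y) => a c [d e] /=; ring.
have -> : (fun y => complex.Im ((b x y)%:C * (u x - u y))) =
          (fun y => b x y * (complex.Im (u x) - complex.Im (u y))).
  by apply/funext => y; case: (u x) (u y) => a c [d e] /=; ring.
rewrite !(rsum_diff _ _ ur); try by move=> y /u0 ->.
have -> : \sum_(y <- r) b x y * re_dot (u y) (v x) =
   (\sum_(y <- r) b x y * complex.Re (u y)) * complex.Re (v x) +
   (\sum_(y <- r) b x y * complex.Im (u y)) * complex.Im (v x).
  rewrite !mulr_suml -big_split; apply: eq_bigr => y _ /=.
  by rewrite /re_dot mulrDr !mulrA.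
have := mu0 x; move: (\sum_(y <- r) _) (\sum_(y <- r) _) (rsum _).
case: (u x) (v x) (mu x) => a c [d e] m p q s m0; rewrite /re_dot /=.
by field; rewrite gt_eqF.
Qed.

Lemma inner_gram (r : seq X) u v : uniq r ->
  (forall x, x \notin r -> u x = 0) -> (forall x, x \notin r -> v x = 0) ->
  complex.Re (inner mu u v) =
  gram r (fun x y => if x == y then mu y else 0) u v.
Proof.
move=> ur u0 v0; rewrite Re_inner (rsum_seq ur); last first.
  by move=> x /v0 ->; rewrite re_dot0r mulr0.
apply: eq_big_seq => x xr.
rewrite -(sum_delta (fun y => mu y * re_dot (u y) (v x)) ur xr).
by apply: eq_bigr => y _; case: ifP => //; rewrite mul0r.
Qed.

End Kernel.

(** * Sequences with small terms and minimising sequences *)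

Section Sequences.
Context {R : realType}.

(** Used for non-negative sequences and for differences [a n - c], where it
    bounds the upper limit of [a] by [c]; hence no absolute value. *)
Definition eventually_small (a : nat -> R) : Prop :=
  forall e : R, 0 < e -> exists k, forall n, (k <= n)%N -> a n <= e.

Definition eventually_close (T : Type) (dist : T -> T -> R) (x_ : nat -> T) :=
  forall e : R, 0 < e -> exists k, forall m n, (k <= m)%N -> (k <= n)%N ->
    dist (x_ m) (x_ n) <= e.

Lemma cvg0_eventually_small (a : nat -> R) :
  a k @[k --> \oo] --> (0 : R) -> eventually_small (fun k => `|a k|).
Proof.
move=> /cvgr0Pnorm_le a0 e e0; have [k _ ak] := a0 e e0.
by exists k => n kn; apply: ak.
Qed.

Lemma eventually_small_cvg0 (a : nat -> R) :
  eventually_small (fun k => `|a k|) -> a k @[k --> \oo] --> (0 : R).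
Proof.
move=> a0; apply/cvgr0Pnorm_le => e e0; have [k ak] := a0 e e0.
by exists k => // n /= kn; apply: ak.
Qed.

Lemma cvg0_eventually_close (T : Type) (dist : T -> T -> R) (x_ : nat -> T) :
  dist (x_ p.1) (x_ p.2) @[p --> (\oo, \oo)] --> (0 : R) ->
  eventually_close (fun x y => `|dist x y|) x_.
Proof.
move=> /cvgr0Pnorm_le d0 e e0; have [[A B] /= [[i _ iA] [j _ jB]] AB] := d0 e e0.
exists (maxn i j) => m n; rewrite !geq_max => /andP[im jm] /andP[ni nj].
by apply: (AB (m, n)); split; [apply: iA|apply: jB].
Qed.

Lemma harmonic_eventually_small : eventually_small (fun n => n.+1%:R^-1).
Proof.
move=> e e0; have /cvgr0Pnorm_le/(_ _ e0) [k _ kP] := @cvg_harmonic R.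
by exists k => n /kP /=; rewrite ger0_norm// invr_ge0.
Qed.

(** The hypothesis on [dist] is the parallelogram identity with $z$ the midpoint
    of $x$ and $y$.  For $m, n \geq i$ the near-minimisers $x_m$ and $x_n$ have
    a midpoint in $K_i$, so their distance is controlled by the gap between the
    infimum of [a] on $K_i$ and the supremum of all these infima. *)
Lemma minimizing_sequence_close (T : Type) (a : T -> R) (dist : T -> T -> R)
    (K : nat -> set T) (M : R) :
  (forall m n, (m <= n)%N -> K n `<=` K m) ->
  (forall n x, K n x -> 0 <= a x) ->
  (forall n, exists2 x, K n x & a x <= M) ->
  (forall n x y, K n x -> K n y ->
     exists2 z, K n z & dist x y <= 2 * a x + 2 * a y - 4 * a z) ->
  exists2 x_, (forall n, K n (x_ n)) & eventually_close dist x_.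
Proof.
move=> Kmon a0 aM mid; pose I n := inf (a @` K n).
have lbK n : has_lbound (a @` K n) by exists 0 => _ [x Kx <-]; apply: a0 Kx.
have Kn0 n : a @` K n !=set0 by have [x Kx _] := aM n; exists (a x); exists x.
have Ile n x : K n x -> I n <= a x.
  by move=> Kx; apply: ge_inf => //; exists x.
have IM n : I n <= M by have [x Kx] := aM n; apply: le_trans; apply: Ile.
have supI : has_sup (range I).
  by split; [exists (I 0%N); exists 0%N|exists M => _ [n _ <-]].
have Isup n : I n <= sup (range I) by apply: ub_le_sup; [case: supI|exists n].
have near_min n : exists x, K n x /\ a x <= I n + n.+1%:R^-1.
  have n0 : 0 < n.+1%:R^-1 :> R by rewrite invr_gt0.
  have [_ [x Kx <-] /ltW ax] := inf_adherent n0 (conj (Kn0 n) (lbK n)).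
  by exists x.
have [x_ x_P] := choice near_min.
exists x_ => [n|e e0]; first by case: (x_P n).
(* The final bound is a combination of eight terms of size e / 8. *)
have e8 : 0 < e / 8 by rewrite divr_gt0.
have [_ [i _ <-] Ii] := sup_adherent e8 supI.
have [j jP] := harmonic_eventually_small e8.
exists (maxn i j) => m n; rewrite !geq_max => /andP[im jm] /andP[ni nj].
have [Km am] := x_P m; have [Kn an] := x_P n.
have [z Kz] := mid i _ _ (Kmon _ _ im _ Km) (Kmon _ _ ni _ Kn).
have /= := jP m jm; have /= := jP n nj; have := Ile _ _ Kz.
have := Isup m; have := Isup n; move: an am.
by move: (n.+1%:R^-1) (m.+1%:R^-1) => p q *; lra.
Qed.

End Sequences.

(** * The energy form on finitely supported functions *)

Section Energy.
Context {R : realType} {X : countType} (b : X -> X -> R) (mu : X -> R).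
Context (hG : weighted_graph b mu).
Implicit Types (u v w : X -> R[i]) (V : X -> R).

Let mu_gt0 x : 0 < mu x.
Proof. by case: hG => _ [_ [_ [_ []]]]. Qed.

Definition energy V u v : R := complex.Re (inner mu (schrodinger b mu V u) v).

Lemma energyC V u v : finsupp_fun u -> finsupp_fun v ->
  energy V u v = energy V v u.
Proof.
move=> fu fv; have [r [ur u0 v0]] := finsupp_seq fu fv.
rewrite /energy !(schrodinger_gram hG _ ur)//.
by apply: gramC; apply: schr_kernelC.
Qed.

Lemma energyDl V u v w : finsupp_fun u -> finsupp_fun v -> finsupp_fun w ->
  energy V (u \+ v) w = energy V u w + energy V v w.
Proof.
move=> fu fv fw; have [r [ur u0 v0]] := finsupp_seq fu fv.
have [s [us uv0 w0]] := finsupp_seq (finsuppD fu fv) fw.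
have [ur' ] : uniq (undup (r ++ s)) /\ True by rewrite undup_uniq.
have mem x : x \notin undup (r ++ s) -> x \notin r /\ x \notin s.
  by rewrite mem_undup mem_cat negb_or => /andP.
rewrite /energy !(schrodinger_gram hG _ ur'); try by move=> x /mem[? ?]; auto.
by move=> _; rewrite gramDl.
Qed.

Lemma energyBl V u v w : finsupp_fun u -> finsupp_fun v -> finsupp_fun w ->
  energy V (u \- v) w = energy V u w - energy V v w.
Proof.
move=> fu fv fw; have := energyDl V (finsuppB fu fv) fv fw.
have -> : (u \- v) \+ v = u by apply/funext => x /=; rewrite subrK.
by move=> ->; rewrite addrK.
Qed.

Lemma energy_sqrD V u v : finsupp_fun u -> finsupp_fun v ->
  energy V (u \+ v) (u \+ v) = energy V u u + 2 * energy V u v + energy V v v.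
Proof.
move=> fu fv; have fuv := finsuppD fu fv.
rewrite energyDl// !(energyC _ _ fuv)// !energyDl// (energyC _ fv fu).
by ring.
Qed.

Lemma energy_sqrB V u v : finsupp_fun u -> finsupp_fun v ->
  energy V (u \- v) (u \- v) = energy V u u - 2 * energy V u v + energy V v v.
Proof.
move=> fu fv; have fuv := finsuppB fu fv.
rewrite energyBl// !(energyC _ _ fuv)// !energyBl// (energyC _ fv fu).
by ring.
Qed.

(** A lower bound $C$ of the form is absorbed into the potential, so that the
    non-negative form is again of Schroedinger type. *)
Lemma energy_shift V C u v : finsupp_fun u -> finsupp_fun v ->
  energy V u v =
  energy (fun x => V x - C) u v + C * complex.Re (inner mu u v).
Proof.
move=> fu fv; have [r [ur u0 v0]] := finsupp_seq fu fv.
rewrite /energy.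
rewrite (schrodinger_gram hG V ur u0 v0).
rewrite (schrodinger_gram hG _ ur u0 v0).
rewrite (inner_gram _ ur u0 v0).
rewrite /gram mulr_sumr -big_split; apply: eq_bigr => x _ /=.
rewrite mulr_sumr -big_split; apply: eq_bigr => y _ /=.
by rewrite /schr_kernel; case: eqVneq => _; ring.
Qed.

Lemma energy_cmod V u : finsupp_fun u ->
  energy V (fun x => (cmod (u x))%:C) (fun x => (cmod (u x))%:C)
  <= energy V u u.
Proof.
move=> fu; have [r [ur u0 _]] := finsupp_seq fu fu.
have cu0 x : x \notin r -> (cmod (u x))%:C = 0.
  by move=> /u0 ->; rewrite ComplexField.Normc.normc0.
rewrite /energy !(schrodinger_gram hG _ ur)//.
by apply: gram_cmod_le => x y; apply: schr_kernel_le0.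
Qed.

Lemma Re_inner_le u v : finsupp_fun u -> finsupp_fun v ->
  `|complex.Re (inner mu u v)| <= (sqnorm mu u + sqnorm mu v) / 2.
Proof.
move=> fu fv; have [r [ur u0 v0]] := finsupp_seq fu fv.
rewrite Re_inner /sqnorm !(rsum_seq ur); try by
  move=> x xr; rewrite ?(u0 _ xr) ?(v0 _ xr) ?re_dot0l ?re_dot0r mulr0.
rewrite -big_split mulr_suml; apply: le_trans (ler_norm_sum _ _ _) _.
apply: ler_sum => x _; rewrite /= -mulrDr -mulrA normrM gtr0_norm// ler_pM2l//.
have := re_dot_ge0 (u x + v x); have := re_dot_ge0 (u x - v x).
rewrite re_dotBl !re_dotBr re_dotDl !re_dotDr (re_dotC (v x)) ler_norml.
by move=> h1 h2; apply/andP; split; lra.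
Qed.

Context (hFC : FC b mu).

(** The squared $\ell^2$ norm of $L \delta_x$, split into the contribution of
    the vertex $x$ and that of the others; the finiteness condition says that
    the latter is finite. *)
Definition row_bound V (x : X) : R :=
  (rsum (b x) + mu x * V x) ^+ 2 / mu x + rsum (fun y => b x y ^+ 2 / mu y).

Lemma schr_kernel_row V (r : seq X) x : uniq r -> x \in r ->
  \sum_(y <- r) schr_kernel b mu V x y ^+ 2 / mu y <= row_bound V x.
Proof.
have [_ [_ [_ [bxx _]]]] := hG.
move=> ur xr; rewrite /row_bound.
have sb : abs_summable (fun y => b x y ^+ 2 / mu y).
  apply: le_abs_summable ((l2E mu_gt0 _).1 (hFC x)) => y.
  rewrite /re_dot /= mulr0 addr0 -expr2 expr_div_n.
  rewrite [X in _ <= `|X|](_ : _ = b x y ^+ 2 / mu y)//.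
  by field; rewrite gt_eqF.
rewrite -(sum_delta (fun x => (rsum (b x) + mu x * V x) ^+ 2 / mu x) ur xr).
have b0 y : 0 <= b x y ^+ 2 / mu y by rewrite divr_ge0 ?sqr_ge0// ltW.
apply: le_trans (lerD (lexx _) (ler_sum_rsum b0 sb ur)).
(* Since b x x = 0, one of the two summands of an entry always vanishes, so the
   square of the entry is the sum of their squares. *)
rewrite -big_split; apply: ler_sum => y _ /=; rewrite /schr_kernel.
case: eqVneq => [->|_]; last by rewrite sub0r sqrrN add0r.
by rewrite bxx subr0 expr0n mul0r addr0.
Qed.

(** Continuity in $\ell^2$ of $u \mapsto (L u, v)$ in the form of a weighted
    arithmetic-geometric mean inequality, whose free parameter replaces the
    square roots of the Cauchy-Schwarz inequality.  The constants depend on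
    [v] only. *)
Lemma energy_bound V v : finsupp_fun v ->
  exists A B, [/\ 0 <= A, 0 <= B & forall u eta, finsupp_fun u -> 0 < eta ->
  `|energy V u v| <= eta * A + B * sqnorm mu u / eta].
Proof.
move=> fv.
pose A := rsum (fun x => cmod (v x) * row_bound V x).
pose B := rsum (fun x => cmod (v x)).
have rb0 x : 0 <= row_bound V x.
  apply: addr_ge0; first by rewrite divr_ge0 ?sqr_ge0// ltW.
  by apply: rsum_ge0 => y; rewrite divr_ge0 ?sqr_ge0// ltW.
exists A, B; split.
- by apply: rsum_ge0 => x; rewrite mulr_ge0 ?cmod_ge0.
- by apply: rsum_ge0 => x; rewrite cmod_ge0.
move=> u eta fu eta0; have [r [ur u0 v0]] := finsupp_seq fu fv.
have cv0 x : x \notin r -> cmod (v x) = 0.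
  by move=> /v0 ->; rewrite ComplexField.Normc.normc0.
have -> : sqnorm mu u = \sum_(y <- r) mu y * re_dot (u y) (u y).
  by rewrite /sqnorm (rsum_seq ur)// => x /u0 ->; rewrite re_dot0l mulr0.
have -> : A = \sum_(x <- r) cmod (v x) * row_bound V x.
  by rewrite /A (rsum_seq ur)// => x /cv0 ->; rewrite mul0r.
rewrite /B (rsum_seq ur cv0) /energy (schrodinger_gram hG _ ur)//.
set N := \sum_(y <- r) mu y * _.
rewrite mulr_sumr -mulrA mulr_suml -big_split /=.
apply: le_trans (ler_norm_sum _ _ _) _; rewrite big_seq [leRHS]big_seq.
apply: ler_sum => x xr.
apply: le_trans (ler_norm_sum _ _ _) _.
rewrite [leRHS](_ : _ = cmod (v x) * (eta * row_bound V x + N / eta)); last by ring.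
apply: le_trans (ler_wpM2l (cmod_ge0 _) (lerD (ler_wpM2l (ltW eta0)
  (schr_kernel_row V ur xr)) (lexx _))).
rewrite mulr_sumr /N mulr_suml -big_split /= mulr_sumr; apply: ler_sum => y _.
set k := schr_kernel _ _ _ _ _.
have h : `|re_dot (u y) (v x)| <= cmod (u y) * cmod (v x).
  rewrite ler_norml re_dot_le andbT lerNl.
  have := re_dot_le (- u y) (v x).
  rewrite -[- u y]sub0r re_dotBl re_dot0l !sub0r.
  suff -> : cmod (- u y) = cmod (u y) by [].
  by case: (u y) => p q /=; rewrite !sqrrN.
rewrite normrM; apply: le_trans (ler_wpM2l (normr_ge0 _) h) _.
rewrite mulrA [leLHS]mulrC ler_wpM2l ?cmod_ge0// re_dot_sqr.
have m0 := mu_gt0 y; rewrite -[k ^+ 2]real_normK ?num_real//.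
move: (`|k|) (normr_ge0 k) (cmod (u y)) (cmod_ge0 (u y)) => p p0 q q0.
rewrite -subr_ge0.
(* What remains is p q <= eta p^2 / mu + mu q^2 / eta, half as sharp as the
   arithmetic-geometric mean inequality. *)
rewrite [leRHS](_ : _ =
  ((eta * p - mu y * q) ^+ 2 + eta * mu y * p * q) / (eta * mu y)); last first.
  by field; rewrite !gt_eqF.
rewrite divr_ge0//; last by rewrite mulr_ge0// ltW.
by rewrite addr_ge0 ?sqr_ge0// !mulr_ge0// ltW.
Qed.

Lemma energy_eventually_small V v (x_ : nat -> X -> R[i]) :
  finsupp_fun v -> (forall n, finsupp_fun (x_ n)) ->
  eventually_small (fun n => sqnorm mu (x_ n)) ->
  eventually_small (fun n => `|energy V (x_ n) v|).
Proof.
move=> fv fx x0 e e0; have [A [B [A0 B0 AB]]] := energy_bound V fv.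
have [A1 B1] : 0 < A + 1 /\ 0 < B + 1 by rewrite !ltr_wpDl.
have [eta eta0 etaE] : exists2 eta, 0 < eta & eta * (A + 1) = e / 2.
  exists (e / 2 / (A + 1)); last by rewrite divfK ?gt_eqF.
  by apply: divr_gt0 => //; apply: divr_gt0.
have [d d0 dE] : exists2 d, 0 < d & (B + 1) * d = e / 2 * eta.
  exists (e / 2 * eta / (B + 1)); last by rewrite mulrC divfK ?gt_eqF.
  by apply: divr_gt0 => //; apply: mulr_gt0 => //; apply: divr_gt0.
have [k kP] := x0 _ d0; exists k => n kn.
apply: le_trans (AB _ _ (fx n) eta0) _; rewrite [leRHS]splitr; apply: lerD.
  by rewrite -etaE ler_wpM2l ?lerDl// ltW.
rewrite ler_pdivrMr// -dE; apply: ler_pM => //; first exact: sqnorm_ge0.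
  by rewrite lerDl.
exact: kP.
Qed.

(** For fixed $m$ and $n \to \infty$ the mixed term of
    $a(x_m - x_n) = a(x_m) - 2 a(x_m, x_n) + a(x_n)$ tends to $0$ and
    $a(x_n) \geq 0$, so $a(x_m)$ is asymptotically at most $a(x_m - x_n)$,
    which is small once $m$ is large. *)
Lemma energy_closable V (x_ : nat -> X -> R[i]) :
  (forall u, finsupp_fun u -> 0 <= energy V u u) ->
  (forall n, finsupp_fun (x_ n)) ->
  eventually_close (fun u v => energy V (u \- v) (u \- v)) x_ ->
  eventually_small (fun n => sqnorm mu (x_ n)) ->
  eventually_small (fun n => energy V (x_ n) (x_ n)).
Proof.
move=> E0 fx xc x0 e e0; have e2 : 0 < e / 3 by rewrite divr_gt0.
have [k kP] := xc _ e2; exists k => m km.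
have [l lP] := energy_eventually_small V (fx m) fx x0 e2.
have := kP m (maxn k l) km (leq_maxl _ _); have := lP _ (leq_maxr k l).
rewrite energy_sqrB// energyC//; move: (x_ (maxn k l)) (fx (maxn k l)) => y fy.
by rewrite ler_norml => /andP[_ h1]; have := E0 _ fy; lra.
Qed.

End Energy.

(** * Approximation in the closed form *)

Section FriedrichsForm.
Context {R : realType} {X : countType} (b : X -> X -> R) (mu V : X -> R).
Context (hG : weighted_graph b mu).
Context (hFC : FC b mu).
Context (C : R) (energy_ge : forall u : X -> R[i], finsupp_fun u ->
  C * l2norm mu u ^+ 2 <= energy b mu V u u).
Implicit Types (u v w : X -> R[i]).

Let mu_gt0 x : 0 < mu x.
Proof. by case: hG => _ [_ [_ [_ []]]]. Qed.

Let en u : R := energy b mu (fun x => V x - C) u u.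

Let energy_en u : finsupp_fun u -> energy b mu V u u = en u + C * sqnorm mu u.
Proof. by move=> fu; rewrite (energy_shift hG _ C fu fu) Re_inner. Qed.

Let en_ge0 u : finsupp_fun u -> 0 <= en u.
Proof.
move=> fu; have := energy_ge fu; rewrite (energy_en fu) (l2norm_sqr mu_gt0).
by lra.
Qed.

Let enD_le u v : finsupp_fun u -> finsupp_fun v ->
  en (u \+ v) <= 2 * (en u + en v).
Proof.
move=> fu fv; have := en_ge0 (finsuppB fu fv).
by rewrite /en (energy_sqrB hG)// (energy_sqrD hG)//; lra.
Qed.

(** The energies of $u + v$ and $u - v$ are non-negative, which bounds the mixed
    term by the mean of the energies of $u$ and $v$. *)
Let energy_polar_le u v : finsupp_fun u -> finsupp_fun v ->
  `|energy b mu V u v| <=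
  (en u + en v) / 2 + `|C| * ((sqnorm mu u + sqnorm mu v) / 2).
Proof.
move=> fu fv; rewrite (energy_shift hG _ C fu fv).
apply: le_trans (ler_normD _ _) _; rewrite normrM.
apply: lerD; last by rewrite ler_wpM2l// (Re_inner_le hG).
have := en_ge0 (finsuppB fu fv); have := en_ge0 (finsuppD fu fv).
rewrite /en (energy_sqrB hG)// (energy_sqrD hG)// ler_norml.
by move=> h1 h2; apply/andP; split; lra.
Qed.

Let s := form_of_op mu (restrict_op (schrodinger b mu V) (@finsupp_fun R X)).

Let qform_s u : qform s u = energy b mu V u u.
Proof. by []. Qed.

(** The convergence that defines the form closure, expressed with the
    non-negative shifted energy instead of the form itself. *)
Definition energy_cvg (u_ : nat -> X -> R[i]) u : Prop :=
  [/\ forall n, finsupp_fun (u_ n), l2 mu u,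
      eventually_small (fun n => sqnorm mu (u_ n \- u)) &
      eventually_close (fun v w => en (v \- w)) u_].

Let sqnorm_trans u v w : l2 mu u -> l2 mu v -> l2 mu w ->
  sqnorm mu (u \- v) <= 2 * (sqnorm mu (u \- w) + sqnorm mu (v \- w)).
Proof.
move=> lu lv lw; have -> : u \- v = (u \- w) \- (v \- w).
  by apply/funext => x /=; ring.
have [luw _] := sqnormB_le mu_gt0 lu lw; have [lvw _] := sqnormB_le mu_gt0 lv lw.
by have [] := sqnormB_le mu_gt0 luw lvw.
Qed.

Lemma form_cvg_energy_cvg (u_ : nat -> X -> R[i]) u :
  form_cvg mu s u_ u -> energy_cvg u_ u.
Proof.
move=> [dom lu Nu Qu]; have fu n : finsupp_fun (u_ n) by case: (dom n).
have small : eventually_small (fun n => sqnorm mu (u_ n \- u)).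
  move=> e e0; have se0 : 0 < Num.sqrt e by rewrite sqrtr_gt0.
  have [k kP] := cvg0_eventually_small Nu se0; exists k => n /kP h.
  rewrite -(l2norm_sqr mu_gt0) -(sqr_sqrtr (ltW e0)).
  by rewrite ler_sqr ?nnegrE ?sqrtr_ge0// (le_trans _ h)// ler_norm.
split=> // e e0; have C1 : 0 < `|C| + 1 by rewrite ltr_wpDl.
have e2 : 0 < e / 2 by rewrite divr_gt0.
have e8 : 0 < e / (8 * (`|C| + 1)) by rewrite divr_gt0// mulr_gt0.
have [k kP] := cvg0_eventually_close (dist := fun v w => qform s (v \- w)) Qu e2.
have [l lP] := small _ e8; exists (maxn k l) => m n.
rewrite !geq_max => /andP[km lm] /andP[kn ln].
have fmn := finsuppB (fu m) (fu n).
have := kP m n km kn; rewrite qform_s (energy_en fmn) => /ler_normlW h.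
have h1 := sqnorm_trans (finsupp_l2 mu_gt0 (fu m)) (finsupp_l2 mu_gt0 (fu n)) lu.
have h2 : sqnorm mu (u_ m \- u_ n) <= e / (2 * (`|C| + 1)).
  have := lP m lm; have := lP n ln.
  rewrite (_ : e / (2 * _) = 4 * (e / (8 * (`|C| + 1)))); first by lra.
  by field; rewrite gt_eqF.
have h3 : - (C * sqnorm mu (u_ m \- u_ n)) <= e / 2.
  apply: (@le_trans _ _ (`|C| * sqnorm mu (u_ m \- u_ n))).
    by rewrite -mulNr ler_wpM2r ?sqnorm_ge0// -normrN ler_norm.
  apply: le_trans (ler_wpM2l (normr_ge0 C) h2) _.
  rewrite [e / 2](_ : _ = (`|C| + 1) * (e / (2 * (`|C| + 1)))).
    by rewrite ler_wpM2r ?lerDl// ltW// divr_gt0// mulr_gt0.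
  by field; rewrite gt_eqF.
by lra.
Qed.

(** The value of the closure at $v_n - u$ is a limit of $(L p_m, r_m)$, where
    $p_m$ and $r_m$ are arbitrary approximations of $v_n - u$.  So are the
    functions $v_n - v_m$, whose energy is small; by closability the energies
    of $p_m$ and $r_m$ are then small too, and with them the mixed term.  When
    the set of limits is empty the default value of the closure is $0$. *)
Lemma form_closure_eventually_small (v_ : nat -> X -> R[i]) u :
  energy_cvg v_ u ->
  eventually_small (fun n => `|qform (form_closure mu s) (v_ n \- u)|).
Proof.
move=> [fv lu vu vv] e e0.
have C1 : 0 < `|C| + 1 by rewrite ltr_wpDl.
(* The mixed term below is at most 4 d + 2 |C| d, up to errors that vanish in
   the limit; the factor 5 leaves room for them. *)
pose d := e / (5 * (`|C| + 1)).
have d0 : 0 < d by rewrite divr_gt0// mulr_gt0.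
have [k1 k1P] := vu _ d0; have [k2 k2P] := vv _ d0.
exists (maxn k1 k2) => n; rewrite geq_max => /andP[n1 n2].
rewrite /qform /=; case: xgetP => [z _|_]; last by rewrite normr0 ltW.
move=> [p_ [r_ [/form_cvg_energy_cvg pw /form_cvg_energy_cvg rw zlim]]].
(* Any approximation q_ of v_n - u inherits the bounds of v_n - v_m, because
   closability applies to the difference y. *)
have close_to q_ : energy_cvg q_ (v_ n \- u) ->
    eventually_small (fun m => en (q_ m) - 4 * d) /\
    eventually_small (fun m => sqnorm mu (q_ m) - 2 * d).
  move=> [fq lw qw qq]; pose y m := q_ m \- (v_ n \- v_ m).
  have fnm m : finsupp_fun (v_ n \- v_ m) by apply: finsuppB.
  have fy m : finsupp_fun (y m) by apply: finsuppB.
  have lfin w : finsupp_fun w -> l2 mu w by apply: finsupp_l2.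
  have y0 : eventually_small (fun m => sqnorm mu (y m)).
    move=> c c0; have c4 : 0 < c / 4 by rewrite divr_gt0.
    have [i iP] := qw _ c4; have [j jP] := vu _ c4.
    exists (maxn i j) => m; rewrite geq_max => /andP[im jm].
    have -> : y m = (q_ m \- (v_ n \- u)) \+ (v_ m \- u).
      by apply/funext => x; rewrite /y /=; ring.
    have [l1 _] := sqnormB_le mu_gt0 (lfin _ (fq m)) lw.
    have [l2' _] := sqnormB_le mu_gt0 (lfin _ (fv m)) lu.
    have [_] := sqnormD_le mu_gt0 l1 l2'.
    by have := iP m im; have := jP m jm; move=> *; lra.
  have yy : eventually_close (fun v w => en (v \- w)) y.
    move=> c c0; have c4 : 0 < c / 4 by rewrite divr_gt0.
    have [i iP] := qq _ c4; have [j jP] := vv _ c4.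
    exists (maxn i j) => m l; rewrite !geq_max => /andP[im jm] /andP[il jl].
    have -> : y m \- y l = (q_ m \- q_ l) \+ (v_ m \- v_ l).
      by apply/funext => x; rewrite /y /=; ring.
    have := enD_le (finsuppB (fq m) (fq l)) (finsuppB (fv m) (fv l)).
    by have := iP m l im il; have := jP m l jm jl; move=> *; lra.
  have ey := energy_closable hG hFC en_ge0 fy yy y0.
  split=> c c0.
    have c2 : 0 < c / 2 by rewrite divr_gt0.
    have [i iP] := ey _ c2; exists (maxn i k2) => m; rewrite geq_max => /andP[im km].
    have -> : q_ m = y m \+ (v_ n \- v_ m) by apply/funext => x; rewrite /y /=; ring.
    have := enD_le (fy m) (fnm m); have := k2P n m n2 km.
    by have := iP m im; rewrite -/(en _); move=> *; lra.
  have c2 : 0 < c / 2 by rewrite divr_gt0.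
  have [i iP] := qw _ c2; exists i => m im.
  have [l1 _] := sqnormB_le mu_gt0 (lfin _ (fq m)) lw.
  have -> : q_ m = (q_ m \- (v_ n \- u)) \+ (v_ n \- u).
    by apply/funext => x /=; ring.
  have [_] := sqnormD_le mu_gt0 l1 lw.
  by have := iP m im; have := k1P n n1; move=> *; lra.
have [ep sp] := close_to _ pw; have [er sr] := close_to _ rw.
have [fp _ _ _] := pw; have [fr _ _ _] := rw.
have d4 : 0 < d / 4 by rewrite divr_gt0.
have [i1 i1P] := ep _ d4; have [i2 i2P] := sp _ d4.
have [i3 i3P] := er _ d4; have [i4 i4P] := sr _ d4.
have [i5 i5P] := cvg0_eventually_small zlim d4.
have [m [m1 m2 m3 m4 m5]] : exists m, [/\ (i1 <= m)%N, (i2 <= m)%N,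
    (i3 <= m)%N, (i4 <= m)%N & (i5 <= m)%N].
  exists (maxn i1 (maxn i2 (maxn i3 (maxn i4 i5)))).
  by rewrite !leq_max !leqnn !orbT.
have {i1P}h1 := i1P m m1; have {i2P}h2 := i2P m m2.
have {i3P}h3 := i3P m m3; have {i4P}h4 := i4P m m4.
have {i5P}h5 := i5P m m5.
have hS := energy_polar_le (fp m) (fr m).
have h6 : `|complex.Re z| <= `|energy b mu V (p_ m) (r_ m)| + d / 4.
  have -> : complex.Re z = energy b mu V (p_ m) (r_ m)
      - complex.Re (inner mu (schrodinger b mu V (p_ m)) (r_ m) - z).
    by rewrite raddfB /energy opprB addrC subrK.
  apply: le_trans (ler_normB _ _) _; rewrite lerD2l.
  apply: le_trans (norm_Re_le _) _; apply: le_trans h5; exact: ler_norm.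
have h7 : `|C| * ((sqnorm mu (p_ m) + sqnorm mu (r_ m)) / 2) <= `|C| * (3 * d).
  by rewrite ler_wpM2l//; lra.
have h8 : 5 * d * (`|C| + 1) = e by rewrite /d; field; rewrite gt_eqF.
have : 0 <= `|C| * d by rewrite mulr_ge0// ltW.
by lra.
Qed.

(** Near-minimisers of the energy over the sets $K_n$ of non-negative functions
    at squared distance at most $1/(n+1)$ from $u$.  The functions
    $|\phi_m|$ show that these sets are non-empty and that the energy is
    bounded on suitable elements of them, uniformly in $n$. *)
Lemma nonneg_approximation (phi_ : nat -> X -> R[i]) u :
  (forall x, 0 <= u x) -> energy_cvg phi_ u ->
  exists2 v_, (forall n, nonneg_part (@finsupp_fun R X) (v_ n)) &
              energy_cvg v_ u.
Proof.
move=> u0 [fphi lu phiu phiphi].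
have lfin w : finsupp_fun w -> l2 mu w by apply: finsupp_l2.
pose K n : set (X -> R[i]) := [set v | [/\ finsupp_fun v, forall x, 0 <= v x &
  sqnorm mu (v \- u) <= n.+1%:R^-1]].
have half0 : 0 <= 2^-1 :> R by rewrite invr_ge0.
have [k kP] := phiphi 1 ltr01.
have [v_ vK vv] : exists2 v_, (forall n, K n (v_ n)) &
    eventually_close (fun v w => en (v \- w)) v_.
  apply: (@minimizing_sequence_close _ _ en _ K (2 * (1 + en (phi_ k)))).
  - move=> m n mn v [fv v0 vu]; split=> //; apply: le_trans vu _.
    by rewrite lef_pV2 ?posrE// ler_nat.
  - by move=> n v [fv _ _]; apply: en_ge0.
  - move=> n; have n0 : 0 < n.+1%:R^-1 :> R by rewrite invr_gt0.
    have [l lP] := phiu _ n0; pose m := maxn k l.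
    have fpsi : finsupp_fun (fun x => (cmod (phi_ m x))%:C).
      apply: finsupp_sub (fphi m) (fphi m) _ => x ->.
      by rewrite ComplexField.Normc.normc0.
    exists (fun x => (cmod (phi_ m x))%:C).
      split=> // [x|]; first by rewrite lecR cmod_ge0.
      apply: le_trans (lP m (leq_maxr _ _)).
      have [lphi _] := sqnormB_le mu_gt0 (lfin _ (fphi m)) lu.
      suff hx x : re_dot (((fun x => (cmod (phi_ m x))%:C) \- u) x)
                         (((fun x => (cmod (phi_ m x))%:C) \- u) x) <=
          2^-1 * (re_dot ((phi_ m \- u) x) ((phi_ m \- u) x) +
                  re_dot ((phi_ m \- u) x) ((phi_ m \- u) x)).
        by have [_] := sqnorm_le mu_gt0 half0 hx lphi lphi; lra.
      move: (u0 x) (norm_Re_le (phi_ m x)) (re_dot_sqr (phi_ m x)) => /=.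
      case: (phi_ m x) (u x) => p q [c d]; rewrite lecE /= => /andP[/eqP -> c0].
      move: (Num.sqrt _) => t pt; rewrite /re_dot /= => pqt.
      have : c * p <= c * t by rewrite ler_wpM2l// (le_trans (ler_norm _) pt).
      by move=> ?; lra.
    apply: le_trans (energy_cmod hG _ (fphi m)) _.
    have -> : phi_ m = (phi_ m \- phi_ k) \+ phi_ k.
      by apply/funext => x /=; rewrite subrK.
    apply: le_trans (enD_le (finsuppB (fphi m) (fphi k)) (fphi k)) _.
    by have := kP m k (leq_maxl _ _) (leqnn _); move=> *; lra.
  - move=> n v w [fv v0 vu] [fw w0 wu].
    pose z x : R[i] := (2^-1)%:C * (v x + w x).
    have fz : finsupp_fun z.
      by apply: finsupp_sub fv fw _ => x vx wx; rewrite /z vx wx addr0 mulr0.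
    have zz : z \+ z = v \+ w.
      apply/funext => x; rewrite /z /=; case: (v x) (w x) => p q [c d].
      by apply/eqP; rewrite eq_complex /=; apply/andP; split; apply/eqP; field.
    exists z; last first.
      have : en (z \+ z) = en (v \+ w) by rewrite zz.
      rewrite /en /= (energy_sqrB hG)// !(energy_sqrD hG)//.
      by move=> *; lra.
    split=> // [x|].
      by rewrite /z mulr_ge0 ?addr_ge0// lecR.
    have [lvu _] := sqnormB_le mu_gt0 (lfin _ fv) lu.
    have [lwu _] := sqnormB_le mu_gt0 (lfin _ fw) lu.
    suff hx x : re_dot ((z \- u) x) ((z \- u) x) <=
        2^-1 * (re_dot ((v \- u) x) ((v \- u) x) +
                re_dot ((w \- u) x) ((w \- u) x)).
      move: (n.+1%:R^-1) vu wu => d.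
      by have [_] := sqnorm_le mu_gt0 half0 hx lvu lwu; lra.
    rewrite /z /=; case: (v x) (w x) (u x) => p q [c d] [g h].
    rewrite /re_dot /=.
    by have := sqr_ge0 (p - c); have := sqr_ge0 (q - d); lra.
exists v_ => [n|]; first by have [] := vK n.
split=> // [n|e e0]; first by have [] := vK n.
have [k' kP'] := harmonic_eventually_small e0.
by exists k' => n /kP'; apply: le_trans; have [] := vK n.
Qed.

End FriedrichsForm.

Theorem proposition3p10 (R : realType) (X : countType)
    (b : X -> X -> R) (mu : X -> R) (V1 : X -> R) (beta : R)
    (hG : weighted_graph b mu) (hFC : FC b mu) (hbeta : 0 < beta)
    (hV1 : exists C : R, forall u : X -> R[i], finsupp_fun u ->
       C * l2norm mu u ^+ 2 <= complex.Re (inner mu (schrodinger b mu V1 u) u)) :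
  has_positive_form_core beta
    (friedrichs mu (restrict_op (schrodinger b mu V1) (@finsupp_fun R X))).
Proof.
have [C energy_ge] := hV1; move=> u [[phi_ phi_u] u0].
have app := form_cvg_energy_cvg hG C phi_u.
have [v_ v_pos v_u] := nonneg_approximation hG energy_ge u0 app.
exists v_; split=> //=.
have q0 := eventually_small_cvg0
  (form_closure_eventually_small hG hFC energy_ge v_u).
have mu_gt0 : forall x, 0 < mu x by case: hG => _ [_ [_ [_ []]]].
have [_ _ n0 _] := v_u.
set t := form_closure _ _ in q0 *.
have N0 : l2norm mu (v_ k \- u) ^+ 2 @[k --> \oo] --> (0 : R).
  apply: eventually_small_cvg0 => e e0; have [k kP] := n0 _ e0; exists k => n kn.
  by rewrite (l2norm_sqr mu_gt0) ger0_norm ?sqnorm_ge0//; apply: kP.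
rewrite -sqrtr0.
apply: (@continuous_cvg _ _ _ _ _ _ (@Num.sqrt R)); first exact: sqrt_continuous.
rewrite -[X in _ --> X]addr0 -[X in _ --> _ + X](mulr0 (beta - lambda0 mu t)).
by apply: cvgD q0 _; apply: cvgMr.
Qed.
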